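(* Assume the Qualification assumption: there exists $\alpha_0>0$ such that for every $\varepsilon=(\varepsilon_1,\varepsilon_2,\varepsilon_3)\in\mathcal K$ with $\|\varepsilon\|\le\alpha_0$ there exists $\pi:\mathcal T\times S\times S\to\mathbb R$ with $\pi(t,x,\cdot)\in\mathrm{dom}(\ell(t,x,\cdot))$ for all $(t,x)\in\mathcal T\times S$ such that $$m_1[\varepsilon,\pi]\ge 0,\qquad m_2[\varepsilon,\pi](s,\cdot)\in\mathrm{dom}(F(s,\cdot))\ \ \forall s\in\bar{\mathcal T},\qquad D[\varepsilon,\pi](t)\in\mathrm{dom}(\phi(t,\cdot))\ \ \forall t\in\mathcal T .$$ Then the dual problem $$(D)\quad \sup_{(u,\gamma,P)\in\mathcal K}\ \mathcal D(u,\gamma,P):=\sum_{x\in S}m_0(x)u(0,x)-\sum_{t\in\mathcal T}\phi^\star(t,P(t))-\sum_{s\in\bar{\mathcal T}}F^\star(s,\gamma(s,\cdot))$$ $$\text{subject to }\begin{cases}u(t,x)+\ell^\star\big(t,x,-\alpha(t,x,\cdot)P(t)-u(t+1,\cdot)\big)\le\gamma(t,x),&(t,x)\in\mathcal T\times S,\\ u(T,x)=\gamma(T,x),&x\in S,\end{cases}$$ has a non-empty bounded set of solutions, and its value equals the value of $$(\tilde P)\quad \inf_{(m,w)\in\mathcal R}\ \tilde{\mathcal J}(m,w)\quad\text{subject to }\mathbf S w-m+\bar m_0=0 .$$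
   Context: Let $T\ge 1$, $n\ge 1$ be integers, $\mathcal T=\{0,\dots,T-1\}$, $\bar{\mathcal T}=\{0,\dots,T\}$, $S=\{0,\dots,n-1\}$. For a finite set $A$, $\mathbb R(A)$ is the space of functions $A\to\mathbb R$ (Euclidean inner product and norm). Let $\Delta(S)=\{\rho:S\to[0,1]:\sum_{x}\rho(x)=1\}$. Spaces: $\mathcal R=\mathbb R(\bar{\mathcal T}\times S)\times\mathbb R(\mathcal T\times S^2)$, $\mathcal K=\mathbb R(\bar{\mathcal T}\times S)\times\mathbb R(\bar{\mathcal T}\times S)\times\mathbb R(\mathcal T)$. Data: $m_0\in\Delta(S)$, $\alpha:\mathcal T\times S^2\to\mathbb R$, $\ell:\mathcal T\times S\times\mathbb R(S)\to\mathbb R\cup\{+\infty\}$, $\phi:\mathcal T\times\mathbb R\to\mathbb R\cup\{+\infty\}$, $F:\bar{\mathcal T}\times\mathbb R(S)\to\mathbb R\cup\{+\infty\}$. Standing assumption: for all $(t,s,x)\in\mathcal T\times\bar{\mathcal T}\times S$ the functions $\ell(t,x,\cdot)$, $F(s,\cdot)$, $\phi(t,\cdot)$ are proper, convex and lower semicontinuous, and $\mathrm{dom}(\ell(t,x,\cdot))\subseteq\Delta(S)$. The Fenchel conjugates $\ell^\star(t,x,\cdot)$, $F^\star(s,\cdot)$, $\phi^\star(t,\cdot)$ are taken with respect to the last variable. Operators: $\mathbf A[w](t)=\sum_{(x,y)\in S^2}w(t,x,y)\alpha(t,x,y)$; $\mathbf S[w](s,x)=\sum_{y\in S}w(s-1,y,x)$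 if $s>0$, and $\mathbf S[w](0,x)=0$. $\bar m_0\in\mathbb R(\bar{\mathcal T}\times S)$ is $\bar m_0(0,x)=m_0(x)$ and $\bar m_0(s,x)=0$ for $s>0$. Perturbed quantities in the Qualification assumption: for $\varepsilon\in\mathcal K$ and $\pi$ as there, $m_1=m_1[\varepsilon,\pi]\in\mathbb R(\bar{\mathcal T}\times S)$ solves $m_1(0,x)-\varepsilon_1(0,x)=m_0(x)$, $m_1(t+1,x)=\sum_{y\in S}m_1(t,y)\pi(t,y,x)-\varepsilon_1(t+1,x)$ for $t\in\mathcal T$; $m_2[\varepsilon,\pi]=m_1[\varepsilon,\pi]+\varepsilon_2$; $D[\varepsilon,\pi](t)=\sum_{(x,y)\in S^2}m_1[\varepsilon,\pi](t,x)\pi(t,x,y)\alpha(t,x,y)+\varepsilon_3(t)$. Perspective: for $\theta\in\mathbb R$, $z\in\mathbb R(S)$, $\tilde\ell(t,x,\theta,z)=\theta\,\ell(t,x,z/\theta)$ if $\theta>0$; $=0$ if $(\theta,z)=(0,0)$; $=+\infty$ otherwise. Criterion of $(\tilde P)$: $$\tilde{\mathcal J}(m,w)=\sum_{(t,x)\in\mathcal T\times S}\tilde\ell(t,x,m(t,x),w(t,x,\cdot))+\sum_{t\in\mathcal T}\phi(t,\mathbf A[w](t))+\sum_{s\in\bar{\mathcal T}}F(s,m(s,\cdot)).$$ *)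

(* Defs.v *)
From HB Require Import structures.
From mathcomp Require Import all_boot all_order all_algebra.
From mathcomp Require Import all_classical all_reals all_analysis.

Set Implicit Arguments.
Unset Strict Implicit.
Unset Printing Implicit Defensive.

Import Order.TTheory GRing.Theory Num.Theory.
Import numFieldNormedType.Exports.

Local Open Scope classical_set_scope.
Local Open Scope ring_scope.

(* Time and state sets are [{0..T-1} = 'I_T], [{0..T} = 'I_T.+1] and
   [S = 'I_n].  A function on [S] is a row vector ['rV[R]_n], a function on
   [{0..T} * S] is a matrix ['M[R]_(T.+1, n)] whose row [s] is the function at
   time [s], and a function on [{0..T-1} * S^2] is a family of square matrices
   indexed by ['I_T], so that [w(t, x, .)] is [row x (w t)]. *)

Section ConvexAnalysis.
Context {R : realType}.
Local Open Scope ereal_scope.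

Definition edom {V : Type} (f : V -> \bar R) : set V := [set x | f x < +oo].

Definition proper_fun {V : Type} (f : V -> \bar R) : Prop :=
  (forall x, f x != -oo) /\ edom f !=set0.

(* For functions that never take the value [-oo] no sum [+oo + -oo] occurs,
   and [0 * +oo = 0] makes the cases [a = 0] and [a = 1] trivial. *)
Definition econvex {V : lmodType R} (f : V -> \bar R) : Prop :=
  forall (x y : V) (a : R), (0 <= a <= 1)%R ->
    f (a *: x + (1 - a) *: y)%R <= a%:E * f x + (1 - a)%:E * f y.

Definition proper_convex_lsc {V : normedModType R} (f : V -> \bar R) : Prop :=
  [/\ proper_fun f, econvex f & lower_semicontinuous f].

Definition dotv {n : nat} (x y : 'rV[R]_n) : R := (\sum_i x 0 i * y 0 i)%R.

Definition fenchel {V : Type} (dot : V -> V -> R) (f : V -> \bar R) (p : V)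
    : \bar R :=
  ereal_sup (range (fun x => (dot p x)%:E - f x)).

Definition conjv {n : nat} (f : 'rV[R]_n -> \bar R) : 'rV[R]_n -> \bar R :=
  fenchel dotv f.

Definition conjr (f : R -> \bar R) : R -> \bar R := fenchel *%R f.

Definition perspective {n : nat} (f : 'rV[R]_n -> \bar R)
    (theta : R) (z : 'rV[R]_n) : \bar R :=
  if (0 < theta)%R then theta%:E * f (theta^-1 *: z)%R
  else if (theta == 0%R) && (z == 0%R) then 0 else +oo.

Definition simplex {n : nat} : set 'rV[R]_n :=
  [set rho | (forall x, 0 <= rho 0 x <= 1)%R /\ (\sum_x rho 0 x = 1)%R].

End ConvexAnalysis.

(* The two embeddings of [{0..T-1}] in [{0..T}]: [t |-> t] and [t |-> t + 1]. *)
Definition tcur {T : nat} (t : 'I_T) : 'I_T.+1 := widen_ord (leqnSn T) t.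
Definition tsucc {T : nat} (t : 'I_T) : 'I_T.+1 := lift ord0 t.

Definition spaceR (R : realType) (T n : nat) : Type :=
  ('M[R]_(T.+1, n) * {ffun 'I_T -> 'M[R]_n})%type.

Definition spaceK (R : realType) (T n : nat) : Type :=
  ('M[R]_(T.+1, n) * 'M[R]_(T.+1, n) * 'rV[R]_T)%type.

(* Euclidean norm; the library's norm on matrices and pairs is the sup norm. *)
Definition normK {R : realType} {T n : nat} (k : spaceK R T n) : R :=
  let: (k1, k2, k3) := k in
  Num.sqrt (\sum_s \sum_x k1 s x ^+ 2 + \sum_s \sum_x k2 s x ^+ 2
            + \sum_t k3 0 t ^+ 2).

Section Operators.
Context {R : realType} {T n : nat}.
Implicit Types alpha w pi : 'I_T -> 'M[R]_n.

Definition opA alpha w (t : 'I_T) : R := \sum_x \sum_y w t x y * alpha t x y.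

(* [unlift ord0 s] is [Some t] when [s = t + 1], and [None] when [s = 0]. *)
Definition opS w : 'M[R]_(T.+1, n) :=
  \matrix_(s, x) if unlift ord0 s is Some t then \sum_y w t y x else 0.

Definition m0bar (m0 : 'rV[R]_n) : 'M[R]_(T.+1, n) :=
  \matrix_(s, x) if s == ord0 then m0 0 x else 0.

(* [m1] is the perturbed distribution m_1[eps, pi]. *)
Definition solves_m1 (m0 : 'rV[R]_n) (eps : spaceK R T n) pi (m1 : 'M[R]_(T.+1, n)) : Prop :=
  let: (eps1, _, _) := eps in
  (forall x, m1 ord0 x - eps1 ord0 x = m0 0 x) /\
  (forall t x, m1 (tsucc t) x
               = \sum_y m1 (tcur t) y * pi t y x - eps1 (tsucc t) x).

Lemma solves_m1_exists_unique (m0 : 'rV[R]_n) (eps : spaceK R T n) pi :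
  exists! m1, solves_m1 m0 eps pi m1.
Proof.
case: eps => [[e1 e2] e3].
pose st (s : nat) (v : 'rV[R]_n) : 'rV[R]_n :=
  if insub s is Some t then \row_x (\sum_y v 0 y * pi t y x - e1 (tsucc t) x)
  else 0.
pose v := fix v s := if s is s'.+1 then st s' (v s')
                     else \row_x (m0 0 x + e1 ord0 x).
have vS (t : 'I_T) x : v t.+1 0 x = \sum_y v t 0 y * pi t y x - e1 (tsucc t) x.
  by rewrite /= /st valK mxE.
exists (\matrix_(s < T.+1, x < n) v s 0 x); split.
  split=> [x|t x]; first by rewrite !mxE addrK.
  rewrite mxE lift0 vS; congr (_ - _).
  by apply: eq_bigr => y _; rewrite mxE.
move=> m [mz mS]; suff vm s (lt_s : (s < T.+1)%N) x : v s 0 x = m (Ordinal lt_s) x.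
  by apply/matrixP => -[s lt_s] x; rewrite mxE vm.
elim: s => [|s IHs] in lt_s x *.
  by rewrite mxE -mz (_ : Ordinal lt_s = ord0) ?subrK //; exact/val_inj.
have lt_sT : (s < T)%N by rewrite ltnS in lt_s.
rewrite (vS (Ordinal lt_sT)) (_ : Ordinal lt_s = tsucc (Ordinal lt_sT)); last first.
  exact/val_inj.
rewrite mS; congr (_ - _); apply: eq_bigr => y _; congr (_ * _).
by rewrite (IHs (ltnW lt_s)); congr (m _ y); exact/val_inj.
Qed.

Definition perturbed_D alpha (eps : spaceK R T n) pi (m1 : 'M[R]_(T.+1, n))
    (t : 'I_T) : R :=
  let: (_, _, eps3) := eps in
  \sum_x \sum_y m1 (tcur t) x * pi t x y * alpha t x y + eps3 0 t.

End Operators.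

Section Problems.
Context {R : realType} {T n : nat}.
Variables (m0 : 'rV[R]_n) (alpha : 'I_T -> 'M[R]_n)
  (ell : 'I_T -> 'I_n -> 'rV[R]_n -> \bar R)
  (phi : 'I_T -> R -> \bar R)
  (F : 'I_T.+1 -> 'rV[R]_n -> \bar R).

Definition standing_assumption : Prop :=
  [/\ forall t x, proper_convex_lsc (ell t x),
      forall s, proper_convex_lsc (F s),
      forall t, @proper_convex_lsc R R^o (phi t)
    & forall t x, edom (ell t x) `<=` simplex].

Definition qualification : Prop :=
  exists2 alpha0 : R, 0 < alpha0 & forall eps : spaceK R T n,
    normK eps <= alpha0 ->
    exists pi : 'I_T -> 'M[R]_n,
      (forall t x, edom (ell t x) (row x (pi t))) /\
      exists m1 : 'M[R]_(T.+1, n),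
        [/\ solves_m1 m0 eps pi m1,
            forall s x, 0 <= m1 s x,
            forall s, edom (F s) (row s (m1 + eps.1.2))
          & forall t, edom (phi t) (perturbed_D alpha eps pi m1 t)].

Local Open Scope ereal_scope.

(* Under the standing assumption no term below is [-oo] in the primal
   criterion and none is [+oo] in the dual one, so the conventions of the
   library for [+oo + -oo] are never used. *)
Definition primal_criterion (mw : spaceR R T n) : \bar R :=
  let: (m, w) := mw in
  \sum_(t < T) \sum_(x < n) perspective (ell t x) (m (tcur t) x) (row x (w t))
  + \sum_(t < T) phi t (opA alpha w t)
  + \sum_(s < T.+1) F s (row s m).

Definition primal_feasible : set (spaceR R T n) :=
  [set mw : spaceR R T n | let: (m, w) := mw in opS w - m + m0bar m0 = 0]%R.

Definition primal_value : \bar R :=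
  ereal_inf [set primal_criterion mw | mw in primal_feasible].

Definition dual_criterion (k : spaceK R T n) : \bar R :=
  let: (u, gamma, P) := k in
  (\sum_(x < n) m0 ord0 x * u ord0 x)%R%:E
  - \sum_(t < T) conjr (phi t) (P ord0 t)
  - \sum_(s < T.+1) conjv (F s) (row s gamma).

Definition dual_feasible : set (spaceK R T n) :=
  [set k : spaceK R T n | let: (u, gamma, P) := k in
    (forall t x,
      (u (tcur t) x)%:E
      + conjv (ell t x) (- (P ord0 t *: row x (alpha t)) - row (tsucc t) u)%R
      <= (gamma (tcur t) x)%:E) /\
    (forall x, u ord_max x = gamma ord_max x)].

Definition dual_value : \bar R :=
  ereal_sup [set dual_criterion k | k in dual_feasible].

Definition dual_solutions : set (spaceK R T n) :=
  [set k | dual_feasible k /\ dual_criterion k = dual_value].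

End Problems.

(* Main.v *)
Require Import Defs.
From mathcomp Require Import all_boot all_order all_algebra.
From mathcomp Require Import all_classical all_reals all_analysis.
From mathcomp Require Import finmap ring lra.
Import Order.TTheory GRing.Theory Num.Theory.
Import numFieldNormedType.Exports.
Local Open Scope classical_set_scope.
Local Open Scope ring_scope.

Set Implicit Arguments.
Unset Strict Implicit.
Unset Printing Implicit Defensive.

(** The proof is conjugate duality.  Perturb the primal problem by
    [k = (k1, k2, k3)]: replace the constraint by [m - S w - m0bar = k1] and
    evaluate [F] at [m + k2] and [phi] at [A w + k3].  Let [V k] be the value of
    the perturbed problem.  The perspective of a convex function is jointly
    convex, hence so is the perturbed criterion, and [V] is convex.  Its
    conjugate at [(u, gamma, P)] is the supremum over [(m, w, a, b)], with
    [a = A w + k3] and [b = m + k2], of a Lagrangian that is separable: the part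
    in [(a, b)] gives [phi^*] and [F^*], the part in [(m, w)] is positively
    homogeneous and so has supremum 0 or [+oo] according to whether
    [(u, gamma, P)] is feasible for (D).  Thus (D) maximizes [- V^*], its value
    is at most [V 0], and a subgradient of [V] at 0 is exactly a feasible point
    at which the dual criterion reaches [V 0].

    It remains to see that [V] has subgradients at 0, forming a bounded set.
    The value [V 0] is finite: masses are conserved, so that [(m, w)] ranges
    over a bounded set, on which lower semicontinuous functions are bounded
    below ([value_epi_bounded_below]).  The qualification assumption says that
    [V] is finite near 0 ([value_epi_absorbing]).  A convex function on a space
    of finite dimension has a subgradient at such a point
    ([subgradient_seq]).  The subgradients [y] are bounded because, for each
    direction [d] and a small [t > 0], [t <y, d> <= V (t d) - V 0] is finite.

    To stay within real numbers, [V] is replaced by the set [value_epi] of pairs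
    [(k, r)] such that some point of the perturbed problem has all the terms of
    its criterion bounded by reals of sum [r].  The inequality of weak duality
    ([weak_duality]) and its converse ([supporting_feasible] and
    [supporting_dual_criterion]) are then statements on affine minorants of that
    set. *)

(** * Affine minorants of convex sets of pairs *)

Section Subgradient.
Context {R : realType} {L : lmodType R}.
Implicit Types E : L -> R -> Prop.

(** [E] plays the part of the epigraph of a convex function on [L]. *)
Definition convex_epi E := forall x y r s a, 0 <= a <= 1 ->
  E x r -> E y s -> E (a *: x + (1 - a) *: y) (a * r + (1 - a) * s).

(** The function of epigraph [E] is finite somewhere on each open half-line
    from 0: an algebraic form of 0 being interior to its domain. *)
Definition absorbing_epi E := forall d, exists t, exists2 r, 0 < t & E (t *: d) r.

(** On the line spanned by [e], the infimum of the difference quotients on the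
    positive side is a subgradient: by convexity it is at least all quotients
    on the negative side. *)
Lemma slope_along E (v0 : R) e : convex_epi E -> absorbing_epi E ->
  (forall r, E 0 r -> v0 <= r) ->
  exists c, forall t r, E (t *: e) r -> v0 + t * c <= r.
Proof.
move=> cE aE lE.
have key t s r r' : 0 < t -> 0 < s -> E (t *: e) r -> E (- s *: e) r' ->
    - ((r' - v0) / s) <= (r - v0) / t.
  move=> t0 s0 Er Er'; have ts0 : 0 < s + t by lra.
  have a01 : 0 <= s / (s + t) <= 1.
    by rewrite ler_pdivrMr// mul1r lerDl divr_ge0 ltW.
  (* The weights [s] and [t] bring [t e] and [- s e] to the centre 0. *)
  have := cE _ _ _ _ _ a01 Er Er'; rewrite !scalerA -scalerDl.
  have -> : s / (s + t) * t + (1 - s / (s + t)) * - s = 0.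
    by field; rewrite gt_eqF.
  rewrite scale0r => /lE.
  have -> : s / (s + t) * r + (1 - s / (s + t)) * r' = (s * r + t * r') / (s + t).
    by field; rewrite gt_eqF.
  rewrite ler_pdivlMr// => h.
  rewrite -subr_ge0 (_ : _ - _ = (s * r + t * r' - v0 * (s + t)) / (s * t)).
    by rewrite divr_ge0 ?subr_ge0// ltW ?mulr_gt0.
  by field; rewrite !gt_eqF.
pose A := [set q | exists t, exists2 r, 0 < t & E (t *: e) r /\ q = (r - v0) / t].
have [s [r' s0]] := aE (- e); rewrite scalerN -scaleNr => Er'.
have [t1 [r1 t10 Er1]] := aE e.
have A0 : A !=set0 by exists ((r1 - v0) / t1), t1, r1.
have Alb : has_lbound A.
  exists (- ((r' - v0) / s)) => q [t [r t0 [Er ->]]]; exact: key.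
exists (inf A) => t r Er; have [t0|t0|t0] := ltgtP 0 t.
- have := @ge_inf _ A Alb ((r - v0) / t).
  rewrite ler_pdivlMr// => h; have {h} : inf A * t <= r - v0 by apply: h; exists t, r.
  lra.
- have nt0 : 0 < - t by lra.
  have : - ((r - v0) / - t) <= inf A.
    apply: lb_le_inf => // q [t' [r2 t'0 [Er2 ->]]].
    by apply: key => //; rewrite opprK.
  by rewrite invrN mulrN opprK ler_ndivrMr//; lra.
- by move: Er; rewrite -t0 scale0r mul0r addr0 => /lE.
Qed.

(** Existence of subgradients at 0, with one direction treated at a time.  Once
    a slope [c0] is found along [e i], the set [E] is replaced by its sweep [E']
    along the line spanned by [(e i, c0)].  The sweep is again convex and
    contains [E], and the choice of [c0] keeps [v0] a lower bound at 0; being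
    invariant under the translations by [(e i, c0)], it forces the slope along
    [e i] of every affine minorant found later to be [c0]. *)
Lemma subgradient_seq (I : eqType) (e : I -> L) (s : seq I) E (v0 : R) :
  uniq s -> convex_epi E -> absorbing_epi E -> (forall r, E 0 r -> v0 <= r) ->
  exists c : I -> R, forall (a : I -> R) r,
    E (\sum_(i <- s) a i *: e i) r -> v0 + \sum_(i <- s) a i * c i <= r.
Proof.
elim: s E => [|i s IH] E /=.
  move=> _ _ _ lE; exists (fun=> 0) => a r; rewrite !big_nil addr0.
  exact: lE.
move=> /andP[is_ us] cE aE lE; have [c0 hc0] := slope_along (e i) cE aE lE.
pose E' x r := exists t, E (x + t *: e i) (r + t * c0).
have cE' : convex_epi E'.
  move=> x y r1 r2 a a01 [t1 h1] [t2 h2]; exists (a * t1 + (1 - a) * t2).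
  have := cE _ _ _ _ _ a01 h1 h2; congr E; last by lra.
  by rewrite [in LHS]scalerDr [in LHS]scalerDr [X in _ = _ + X]scalerDl !scalerA addrACA.
have aE' : absorbing_epi E'.
  move=> d; have [t [r t0 Er]] := aE d; exists t, r => //; exists 0.
  by rewrite scale0r mul0r !addr0.
have lE' r : E' 0 r -> v0 <= r.
  by move=> [t]; rewrite add0r => /hc0; rewrite lerD2r.
have [c hc] := IH E' us cE' aE' lE'.
exists (fun j => if j == i then c0 else c j) => a r; rewrite !big_cons eqxx => Er.
have -> : \sum_(j <- s) a j * (if j == i then c0 else c j) =
          \sum_(j <- s) a j * c j.
  by rewrite !big_seq; apply: eq_bigr => j js; case: eqP js is_ => // -> ->.
have : E' (\sum_(j <- s) a j *: e j) (r - a i * c0).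
  by exists (a i); rewrite addrC subrK.
by move/hc; lra.
Qed.

End Subgradient.

(** * Suprema of separable sums and lower bounds on compact sets *)

(** A bound on all the sums [\sum_i b i], with the [b i] chosen independently,
    passes to the sum of the suprema. *)
Lemma separable_sup {R : realType} (I : finType) (B : I -> set R) (c : R) :
  (forall i, B i !=set0) ->
  (forall b, (forall i, B i (b i)) -> \sum_i b i <= c) ->
  exists s : I -> R, (forall i x, B i x -> x <= s i) /\ \sum_i s i <= c.
Proof.
move=> B0 hB.
have Bub i : has_ubound (B i).
  have [b0 hb0] := choice B0.
  exists (c - \sum_(j | j != i) b0 j) => x Bx.
  have := hB (fun j => if j == i then x else b0 j).
  rewrite (bigD1 i)//= eqxx.
  have -> : \sum_(j | j != i) (if j == i then x else b0 j) = \sum_(j | j != i) b0 j.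
    by apply: eq_bigr => j /negbTE ->.
  suff hj j : B j (if j == i then x else b0 j) by move=> /(_ hj); lra.
  by case: eqP => [->|].
exists (fun i => sup (B i)); split=> [i x Bx|]; first exact: ub_le_sup.
apply/ler_addgt0Pr => e e0.
(* The tolerance [e] is shared among the [#|I|] indices; [+ 1] covers an
   empty [I]. *)
pose d := e / (#|I|%:R + 1).
have d0 : 0 < d by rewrite divr_gt0// ltr_wpDl.
have hi i : exists x, B i x /\ sup (B i) - d < x.
  by have [x Bx xd] := sup_adherent d0 (conj (B0 i) (Bub i)); exists x.
have [b hb] := choice hi.
have /hB le_c : forall i, B i (b i) by move=> i; case: (hb i).
apply: (@le_trans _ _ (\sum_i b i + \sum_(i : I) d)).
  by rewrite -big_split /=; apply: ler_sum => i _; case: (hb i) => _; lra.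
rewrite lerD// sumr_const -mulr_natl /d mulrA ler_pdivrMr ?ltr_wpDl//.
by rewrite mulrC ler_pM2l// lerDl.
Qed.

(** The open sets [f > - i] increase to the whole space, so one of them contains
    [K]. *)
Lemma lsc_bounded_below {R : realType} (X : ptopologicalType) (K : set X)
    (f : X -> \bar R) :
  compact K -> lower_semicontinuous f -> (forall x, f x != -oo%E) ->
  exists2 C : R, 0 <= C & forall x, K x -> ((- C)%:E <= f x)%E.
Proof.
move=> cK /lower_semicontinuousP lf fNy.
move: cK; rewrite compact_cover.
move=> /(_ nat setT (fun i => [set x | ((- i%:R)%:E < f x)%E])).
case=> [i _|x _|D _ KD]; first exact: lf.
  have := fNy x; case fx : (f x) => [r| |] // _; last first.
    by exists 0%N => //=; rewrite fx ltry.
  exists (Num.truncn `|r|).+1 => //=; rewrite fx lte_fin.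
  have := truncnS_gt `|r|; have := ler_norm (- r); rewrite normrN; lra.
(* The sum of the indices of the finite subcover is a cheap upper bound of
   their maximum. *)
exists (\sum_(i <- D) i%:R); first by apply: sumr_ge0.
move=> x /KD[i iD /= /ltW]; apply: le_trans; rewrite lee_fin lerN2.
by rewrite (big_rem i)//= lerDl sumr_ge0.
Qed.

(** * Conjugates and perspectives *)

Section ConvexFunctions.
Context {R : realType}.

Lemma econvex_epi (V : lmodType R) (f : V -> \bar R) x y (r s a : R) :
  econvex f -> 0 <= a <= 1 -> (f x <= r%:E)%E -> (f y <= s%:E)%E ->
  (f (a *: x + (1 - a) *: y)%R <= (a * r + (1 - a) * s)%:E)%E.
Proof.
move=> cf a01 fx fy; apply: (le_trans (cf _ _ _ a01)).
have [a0 a1] := andP a01.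
by rewrite [leRHS]EFinD !EFinM leeD// lee_wpmul2l// lee_fin; lra.
Qed.

Lemma finite_epi (V : Type) (f : V -> \bar R) x :
  f x != -oo%E -> edom f x -> f x = (fine (f x))%:E.
Proof. by rewrite /edom /=; case: (f x). Qed.

Lemma fenchel_le (V : Type) (dot : V -> V -> R) (f : V -> \bar R) p (c : R) :
  (forall x, f x != -oo%E) ->
  (forall x r, (f x <= r%:E)%E -> dot p x - r <= c) ->
  (fenchel dot f p <= c%:E)%E.
Proof.
move=> fNy h; apply: ge_ereal_sup => _ [x _ <-].
have := fNy x; case fx : (f x) => [r| |] // _; last by rewrite leNye.
by rewrite -EFinB lee_fin; apply: h; rewrite fx.
Qed.

Lemma fenchel_young (V : Type) (dot : V -> V -> R) (f : V -> \bar R) p x (r : R) :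
  (f x <= r%:E)%E -> ((dot p x - r)%:E <= fenchel dot f p)%E.
Proof.
move=> fx; apply: (@le_trans _ _ ((dot p x)%:E - f x)%E).
  by rewrite EFinB leeB.
by apply: ereal_sup_ubound; exists x.
Qed.

Lemma perspective_leP n (f : 'rV[R]_n -> \bar R) th z (r : R) :
  (perspective f th z <= r%:E)%E <->
  (0 < th /\ (f (th^-1 *: z)%R <= (th^-1 * r)%:E)%E) \/ [/\ th = 0, z = 0 & 0 <= r].
Proof.
rewrite /perspective; case: ltP => th0.
  split=> [h|[[_ h]|[th0']]]; last by rewrite th0' ltxx in th0.
    by left; split=> //; rewrite EFinM lee_pdivlMl.
  by rewrite -lee_pdivlMl// -EFinM.
case: ifP => [/andP[/eqP-> /eqP->]|].
  by rewrite lee_fin; split=> [r0|[[]|[]]//]; right.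
move=> h; split=> // -[[//]|[thE zE]].
by rewrite thE zE !eqxx in h.
Qed.

Lemma perspective00_le n (f : 'rV[R]_n -> \bar R) :
  (perspective f 0 0 <= 0%:E)%E.
Proof. by apply/perspective_leP; right. Qed.

Lemma dotv0 n (q : 'rV[R]_n) : dotv q 0 = 0.
Proof. by rewrite /dotv big1// => i _; rewrite mxE mulr0. Qed.

Lemma dotvZr n (q z : 'rV[R]_n) (a : R) : dotv q (a *: z) = a * dotv q z.
Proof.
rewrite /dotv mulr_sumr; apply: eq_bigr => i _.
by rewrite [X in _ * X]mxE mulrCA.
Qed.

Lemma perspective_gtNy n (f : 'rV[R]_n -> \bar R) th z :
  (forall x, f x != -oo%E) -> perspective f th z != -oo%E.
Proof.
move=> fNy; rewrite /perspective; case: ltP => th0; last by case: ifP.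
by have := fNy (th^-1 *: z); case: (f _) => [r| |] // _; rewrite gt0_muley.
Qed.

(** [perspective_scale] and [perspective_add] make the epigraph of a perspective
    a convex cone, which is stronger than joint convexity. *)
Lemma perspective_scale n (f : 'rV[R]_n -> \bar R) th z (r a : R) : 0 <= a ->
  (perspective f th z <= r%:E)%E -> (perspective f (a * th)%R (a *: z)%R <= (a * r)%:E)%E.
Proof.
rewrite le_eqVlt => /predU1P[<- _|a0 /perspective_leP[[th0 h]|[-> -> r0]]].
- by rewrite !mul0r scale0r; apply/perspective_leP; right.
- apply/perspective_leP; left; split; first exact: mulr_gt0.
  have an0 : a != 0 by rewrite gt_eqF.
  rewrite scalerA invfM mulrAC mulVf// mul1r.
  by rewrite (_ : _ * (a * r) = th^-1 * r)//; field; rewrite an0 gt_eqF.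
- apply/perspective_leP; right; rewrite mulr0 scaler0; split=> //.
  exact: mulr_ge0 (ltW a0) r0.
Qed.

Lemma perspective_add n (f : 'rV[R]_n -> \bar R) th th' z z' (r r' : R) :
  econvex f ->
  (perspective f th z <= r%:E)%E -> (perspective f th' z' <= r'%:E)%E ->
  (perspective f (th + th')%R (z + z')%R <= (r + r')%:E)%E.
Proof.
move=> cf /perspective_leP[[th0 h]|[-> -> r0]] /perspective_leP[[th'0 h']|[-> -> r'0]].
- have s0 : 0 < th + th' by rewrite addr_gt0.
  have a01 : 0 <= th / (th + th') <= 1.
    by rewrite ler_pdivrMr// mul1r lerDl divr_ge0 ltW.
  apply/perspective_leP; left; split=> //.
  (* The normalized sum is the barycentre of [z / th] and [z' / th'] with the
     weights [th] and [th']. *)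
  have := econvex_epi cf a01 h h'; rewrite !scalerA.
  have -> : th / (th + th') / th = (th + th')^-1 by field; rewrite !gt_eqF.
  have -> : (1 - th / (th + th')) / th' = (th + th')^-1 by field; rewrite !gt_eqF.
  rewrite -scalerDr => /le_trans; apply; rewrite lee_fin.
  by rewrite le_eqVlt; apply/predU1P; left; field; rewrite !gt_eqF.
- apply/perspective_leP; left; rewrite !addr0; split=> //.
  by apply: (le_trans h); rewrite lee_fin ler_pM2l ?invr_gt0// lerDl.
- apply/perspective_leP; left; rewrite !add0r; split=> //.
  by apply: (le_trans h'); rewrite lee_fin ler_pM2l ?invr_gt0// lerDr.
- by apply/perspective_leP; right; rewrite !addr0 addr_ge0.
Qed.

Lemma perspective_epi n (f : 'rV[R]_n -> \bar R) th th' z z' (r r' a : R) :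
  econvex f -> 0 <= a <= 1 ->
  (perspective f th z <= r%:E)%E -> (perspective f th' z' <= r'%:E)%E ->
  (perspective f (a * th + (1 - a) * th')%R (a *: z + (1 - a) *: z')%R
     <= (a * r + (1 - a) * r')%:E)%E.
Proof.
move=> cf /andP[a0 a1] h h'.
by apply: perspective_add => //; apply: perspective_scale => //; rewrite subr_ge0.
Qed.

(** The Fenchel-Young inequality at [z / th], multiplied by [th]: a dual
    constraint at [(t, x)] makes the corresponding term of the Lagrangian
    nonpositive. *)
Lemma perspective_young n (f : 'rV[R]_n -> \bar R) th z (r d : R) q :
  (d%:E + conjv f q <= 0)%E -> (perspective f th z <= r%:E)%E ->
  d * th + dotv q z <= r.
Proof.
move=> hd /perspective_leP[[th0 h]|[-> -> r0]]; last first.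
  by rewrite mulr0 add0r dotv0.
have := le_trans (leeD2l d%:E (fenchel_young dotv q h)) hd.
rewrite -EFinD lee_fin => h1.
have -> : dotv q z = th * dotv q (th^-1 *: z).
  by rewrite dotvZr mulVKf ?gt_eqF.
have : th * (d + (dotv q (th^-1 *: z) - th^-1 * r)) <= 0.
  by rewrite pmulr_rle0.
by rewrite !mulrDr mulrN mulrA mulfV ?gt_eqF// mul1r; lra.
Qed.

(** A finite perspective carries the mass [th] along a probability vector, so
    that [z] is a nonnegative vector of mass [th]. *)
Lemma perspective_bounds n (f : 'rV[R]_n -> \bar R) th z (r C : R) :
  edom f `<=` simplex ->
  (forall x : 'rV[R]_n, (forall i, 0 <= x 0 i <= 1) -> ((- C)%:E <= f x)%E) ->
  (perspective f th z <= r%:E)%E ->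
  [/\ forall i, 0 <= z 0 i, \sum_i z 0 i = th & - (th * C) <= r].
Proof.
move=> fS fC /perspective_leP[[th0 h]|[-> -> r0]]; last first.
  split=> [i||]; first by rewrite mxE.
    by rewrite big1// => i _; rewrite mxE.
  by rewrite mul0r oppr0.
have [x01 x1] := fS _ (le_lt_trans h (ltry _)).
split.
- move=> i; have /andP[+ _] := x01 i; rewrite mxE pmulr_rge0// invr_gt0//.
- move: x1; under eq_bigr do rewrite mxE.
  rewrite -mulr_sumr => e.
  by rewrite -[LHS](mulVKf (lt0r_neq0 th0)) e mulr1.
- have := le_trans (fC _ x01) h; rewrite lee_fin ler_pdivlMl//.
  by rewrite mulrN.
Qed.

(** An affine function that is nonpositive on a half-line has a nonpositive
    slope; this recovers the dual constraints from a subgradient inequality. *)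
Lemma ray_le0 (C d : R) : (forall th, 0 < th -> C + th * d <= 0) -> d <= 0.
Proof.
move=> h; rewrite leNgt; apply/negP => d0.
have p : 0 < (`|C| + 1) / d by rewrite divr_gt0// ltr_wpDl.
have := h _ p; rewrite divfK ?gt_eqF//.
by have := ler_norm (- C); rewrite normrN; lra.
Qed.

Lemma shift_le0 (u g : R) (c : \bar R) :
  (u%:E + c <= g%:E)%E = ((u - g)%:E + c <= 0)%E.
Proof.
case: c => [c| |]; last by rewrite !addeNy !leNye.
  by rewrite -!EFinD !lee_fin addrAC subr_le0.
by rewrite !addey// !leye_eq.
Qed.

End ConvexFunctions.

(** * The space of perturbations *)

Section DualVariables.
Context {R : realType} {T n : nat}.
Implicit Types k y : spaceK R T n.

Definition dotK y k : R :=
  \sum_s \sum_x y.1.1 s x * k.1.1 s x + \sum_s \sum_x y.1.2 s x * k.1.2 s x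
  + \sum_t y.2 0 t * k.2 0 t.

Lemma dotKC y k : dotK y k = dotK k y.
Proof.
rewrite /dotK; congr (_ + _ + _).
- by apply: eq_bigr => s _; apply: eq_bigr => x _; rewrite mulrC.
- by apply: eq_bigr => s _; apply: eq_bigr => x _; rewrite mulrC.
- by apply: eq_bigr => t _; rewrite mulrC.
Qed.

Lemma normKE k : normK k = Num.sqrt (dotK k k).
Proof. by case: k => -[]. Qed.

(** Index set of the canonical basis of [spaceK]. *)
Definition coordK : Type := (('I_T.+1 * 'I_n) + ('I_T.+1 * 'I_n) + 'I_T)%type.

Definition unitK (i : coordK) : spaceK R T n :=
  match i with
  | inl (inl (s, x)) => (delta_mx s x, 0, 0)
  | inl (inr (s, x)) => (0, delta_mx s x, 0)
  | inr t => (0, 0, delta_mx 0 t)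
  end.

Definition vecK (c : coordK -> R) : spaceK R T n :=
  (\matrix_(s, x) c (inl (inl (s, x))), \matrix_(s, x) c (inl (inr (s, x))),
   \row_t c (inr t)).

Lemma sum_coordK (V : nmodType) (f : coordK -> V) :
  \sum_i f i = \sum_s \sum_x f (inl (inl (s, x)))
    + \sum_s \sum_x f (inl (inr (s, x))) + \sum_t f (inr t).
Proof. by rewrite !big_sumType /= !pair_bigA; congr (_ + _ + _); apply: eq_bigr => -[]. Qed.

Lemma dotK_vecK c c' : dotK (vecK c) (vecK c') = \sum_i c i * c' i.
Proof.
rewrite sum_coordK /dotK /=; congr (_ + _ + _).
- by apply: eq_bigr => s _; apply: eq_bigr => x _; rewrite !mxE.
- by apply: eq_bigr => s _; apply: eq_bigr => x _; rewrite !mxE.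
- by apply: eq_bigr => t _; rewrite !mxE.
Qed.

Lemma vecK_sum c : vecK c = \sum_i c i *: unitK i.
Proof.
have big0 (V : lmodType R) (J : finType) (f : J -> R) : \sum_j f j *: (0 : V) = 0.
  by rewrite big1// => j _; rewrite scaler0.
have big00 (V : lmodType R) (f : 'I_T.+1 -> 'I_n -> R) :
    \sum_s \sum_x f s x *: (0 : V) = 0.
  by rewrite big1// => s _; exact: big0.
rewrite [RHS]surjective_pairing [X in (X, _)]surjective_pairing.
rewrite !(big_morph (fun k : spaceK R T n => k.1) (fun _ _ => erefl) erefl).
rewrite !(big_morph (fun k : spaceK R T n => k.2) (fun _ _ => erefl) erefl).
rewrite !(big_morph (@fst _ _) (fun _ _ => erefl) erefl).
rewrite !(big_morph (@snd _ _) (fun _ _ => erefl) erefl).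
rewrite !sum_coordK /= !big00 !big0 ?addr0 ?add0r.
congr (_, _, _).
- rewrite [LHS]matrix_sum_delta.
  by apply: eq_bigr => s _; apply: eq_bigr => x _; rewrite mxE.
- rewrite [LHS]matrix_sum_delta.
  by apply: eq_bigr => s _; apply: eq_bigr => x _; rewrite mxE.
- by rewrite [LHS]row_sum_delta; apply: eq_bigr => t _; rewrite mxE.
Qed.

Lemma vecK_onto k : {c | k = vecK c}.
Proof.
case: k => -[k1 k2] k3.
exists (fun i => match i with
  | inl (inl (s, x)) => k1 s x
  | inl (inr (s, x)) => k2 s x
  | inr t => k3 0 t end).
rewrite /vecK; congr (_, _, _).
- by apply/matrixP => s x; rewrite mxE.
- by apply/matrixP => s x; rewrite mxE.
- by apply/rowP => t; rewrite mxE.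
Qed.

Lemma dotKZr y k (a : R) : dotK y (a *: k) = a * dotK y k.
Proof.
have [c ->] := vecK_onto y; have [d ->] := vecK_onto k.
have -> : a *: vecK d = vecK (fun i => a * d i).
  rewrite /vecK; congr (_, _, _).
  - by apply/matrixP => s x; rewrite !mxE.
  - by apply/matrixP => s x; rewrite !mxE.
  - by apply/rowP => t; rewrite !mxE.
by rewrite !dotK_vecK mulr_sumr; apply: eq_bigr => i _; rewrite mulrCA.
Qed.

Lemma dotK_unitK (c : coordK -> R) i : dotK (vecK c) (unitK i) = c i.
Proof.
have -> : unitK i = vecK (fun j => (j == i)%:R : R) :> spaceK R T n.
  rewrite vecK_sum (bigD1 i)//= eqxx scale1r big1 ?addr0// => j /negbTE ->.
  by rewrite scale0r.
rewrite dotK_vecK (bigD1 i)//= eqxx mulr1 big1 ?addr0// => j /negbTE ->.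
by rewrite mulr0.
Qed.

(** In finite dimension, testing against the vectors of the canonical basis and
    their opposites bounds all the coordinates. *)
Lemma bounded_of_directions (Y : set (spaceK R T n)) :
  (forall d, exists B, forall y, Y y -> dotK y d <= B) ->
  exists M, forall y, Y y -> normK y <= M.
Proof.
move=> hY.
have [B hB] := choice (fun i => hY (unitK i)).
have [B' hB'] := choice (fun i => hY (- unitK i)).
exists (Num.sqrt (\sum_i (`|B i| + `|B' i|) ^+ 2)) => y Yy.
have [c yE] := vecK_onto y.
rewrite normKE yE dotK_vecK ler_wsqrtr//; apply: ler_sum => i _.
rewrite -expr2 -real_normK ?num_real//.
rewrite lerXn2r ?nnegrE ?addr_ge0// ler_norml.
have := hB i _ Yy; have := hB' i _ Yy; rewrite -scaleN1r dotKZr yE dotK_unitK.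
have := ler_norm (B i); have := ler_norm (B' i).
have := normr_ge0 (B i); have := normr_ge0 (B' i).
by move=> *; apply/andP; split; lra.
Qed.

End DualVariables.

(** * The Lagrangian *)

Section Lagrangian.
Context {R : realType} {T n : nat}.
Variables (m0 : 'rV[R]_n) (alpha : 'I_T -> 'M[R]_n).

(** The perturbation for which [(m, w)] is feasible while [phi] and [F] are
    evaluated at [a] and [b]. *)
Definition residual (m : 'M[R]_(T.+1, n)) (w : {ffun 'I_T -> 'M[R]_n})
    (a : 'rV[R]_T) (b : 'M[R]_(T.+1, n)) : spaceK R T n :=
  (m - opS w - m0bar m0, b - m, a - \row_t opA alpha w t).

(** The argument of the conjugate of [ell t x] in the dual constraint. *)
Definition conj_point (u : 'M[R]_(T.+1, n)) (P : 'rV[R]_T) t x : 'rV[R]_n :=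
  - (P ord0 t *: row x (alpha t)) - row (tsucc t) u.

Lemma residual_comb m m' w w' a a' b b' (c : R) :
  c *: residual m w a b + (1 - c) *: residual m' w' a' b' =
  residual (c *: m + (1 - c) *: m') (c *: w + (1 - c) *: w')
           (c *: a + (1 - c) *: a') (c *: b + (1 - c) *: b').
Proof.
rewrite /residual; congr (_, _, _).
- apply/matrixP => s x; rewrite !mxE; case: unliftP => [t|] _.
    under [in RHS]eq_bigr do rewrite !ffunE !mxE.
    by rewrite big_split/= -!mulr_sumr; case: ifP => _; ring.
  by case: ifP => _; ring.
- by apply/matrixP => s x; rewrite !mxE; ring.
- apply/rowP => t; rewrite !mxE.
  have -> : opA alpha (c *: w + (1 - c) *: w') t =
     c * opA alpha w t + (1 - c) * opA alpha w' t.
    rewrite /opA !mulr_sumr -big_split; apply: eq_bigr => x _.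
    rewrite !mulr_sumr -big_split; apply: eq_bigr => y _.
    by rewrite /= !ffunE !mxE; ring.
  ring.
Qed.

(** Summation by parts: in the pairing of a dual variable with a residual, the
    terms are collected according to the primal variable that they contain.
    The values [m (t, .)] with [t < T] are kept next to [w t], since they meet in
    the perspective; [m (T, .)] appears in no perspective, whence the equality
    constraint of (D) at the final time. *)
Lemma dotK_residual (u g : 'M[R]_(T.+1, n)) (P : 'rV[R]_T) m w a b :
  dotK (u, g, P) (residual m w a b) =
  - \sum_x m0 0 x * u ord0 x + \sum_t P 0 t * a 0 t
  + \sum_s dotv (row s g) (row s b)
  + \sum_t \sum_x ((u (tcur t) x - g (tcur t) x) * m (tcur t) x
                   + dotv (conj_point u P t x) (row x (w t)))
  + \sum_x (u ord_max x - g ord_max x) * m ord_max x.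
Proof.
rewrite /dotK /=.
have -> : \sum_s \sum_x u s x * (m - opS w - m0bar m0) s x =
   \sum_s \sum_x u s x * m s x
   - \sum_t \sum_x dotv (row (tsucc t) u) (row x (w t))
   - \sum_x m0 0 x * u ord0 x.
  transitivity (\sum_s (\sum_x u s x * m s x - \sum_x u s x * opS w s x
      - \sum_x u s x * m0bar m0 s x)).
    apply: eq_bigr => s _; rewrite -!sumrB; apply: eq_bigr => x _.
    by rewrite !mxE; ring.
  rewrite !sumrB; congr (_ - _ - _).
    rewrite big_ord_recl big1 ?add0r => [|x _]; last first.
      by rewrite mxE unlift_none mulr0.
    apply: eq_bigr => t _; rewrite /dotv exchange_big /=; apply: eq_bigr => x _.
    by rewrite mxE liftK mulr_sumr; apply: eq_bigr => y _; rewrite !mxE.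
  rewrite big_ord_recl [X in _ + X]big1 ?addr0 => [|s _].
    by apply: eq_bigr => x _; rewrite mxE eqxx mulrC.
  by rewrite big1// => x _; rewrite mxE /= mulr0.
have -> : \sum_s \sum_x g s x * (b - m) s x =
    \sum_s dotv (row s g) (row s b) - \sum_s \sum_x g s x * m s x.
  rewrite -sumrB; apply: eq_bigr => s _; rewrite -sumrB; apply: eq_bigr => x _.
  by rewrite !mxE; ring.
have -> : \sum_t P 0 t * (a - \row_t0 opA alpha w t0) 0 t =
    \sum_t P 0 t * a 0 t
    - \sum_t \sum_x dotv (P 0 t *: row x (alpha t)) (row x (w t)).
  rewrite -sumrB; apply: eq_bigr => t _; rewrite !mxE mulrBr; congr (_ - _).
  rewrite /opA mulr_sumr; apply: eq_bigr => x _.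
  by rewrite mulr_sumr; apply: eq_bigr => y _; rewrite !mxE; ring.
have -> : \sum_t \sum_x ((u (tcur t) x - g (tcur t) x) * m (tcur t) x
                   + dotv (conj_point u P t x) (row x (w t))) =
   \sum_t \sum_x (u (tcur t) x - g (tcur t) x) * m (tcur t) x
   - \sum_t \sum_x dotv (P 0 t *: row x (alpha t)) (row x (w t))
   - \sum_t \sum_x dotv (row (tsucc t) u) (row x (w t)).
  rewrite -!sumrB; apply: eq_bigr => t _; rewrite -!sumrB; apply: eq_bigr => x _.
  rewrite -!addrA; congr (_ + _); rewrite -opprD -big_split -sumrN.
  by apply: eq_bigr => y _; rewrite !mxE /=; ring.
(* The final time is split off here, the initial time in the term of [S w]. *)
have : \sum_s \sum_x u s x * m s x - \sum_s \sum_x g s x * m s x =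
   \sum_t \sum_x (u (tcur t) x - g (tcur t) x) * m (tcur t) x
   + \sum_x (u ord_max x - g ord_max x) * m ord_max x.
  rewrite -sumrB big_ord_recr /=; congr (_ + _).
    by apply: eq_bigr => t _; rewrite -sumrB; apply: eq_bigr => x _; rewrite mulrBl.
  by rewrite -sumrB; apply: eq_bigr => x _; rewrite mulrBl.
lra.
Qed.

End Lagrangian.

(** * The perturbed primal problem *)

Section FiniteSums.
Context {R : realType} {I : finType}.
Implicit Types f : I -> \bar R.
Local Open Scope ereal_scope.

Lemma sum_gtNy f : (forall i, f i != -oo) -> \sum_i f i != -oo.
Proof. by move=> fNy; rewrite esum_eqNy; apply/existsP => -[i /=]; apply/negP. Qed.

Lemma sum_finite f : (forall i, f i != -oo) -> \sum_i f i < +oo ->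
  exists2 g : I -> R, forall i, f i = (g i)%:E & \sum_i f i = (\sum_i g i)%R%:E.
Proof.
move=> fNy sf; have fE i : f i = (fine (f i))%:E.
  rewrite fineK// fin_numE fNy /=; apply/eqP => fy; move: sf.
  suff -> : \sum_i f i = +oo by rewrite ltxx.
  by apply/esum_eqyP => //; exists i; rewrite mem_index_enum.
exists (fine \o f) => //; rewrite -sumEFin; exact: eq_bigr.
Qed.

Lemma adde_finite (x y : \bar R) : x != -oo -> y != -oo -> x + y < +oo ->
  x < +oo /\ y < +oo.
Proof. by case: x => [?| |]; case: y => [?| |] //; rewrite !ltry. Qed.

Lemma adde_gtNy (x y : \bar R) : x != -oo -> y != -oo -> x + y != -oo.
Proof. by case: x => [?| |]; case: y. Qed.

End FiniteSums.

Section PerturbedProblem.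
Context {R : realType} {T n : nat}.
Variables (m0 : 'rV[R]_n) (alpha : 'I_T -> 'M[R]_n)
  (ell : 'I_T -> 'I_n -> 'rV[R]_n -> \bar R)
  (phi : 'I_T -> R -> \bar R)
  (F : 'I_T.+1 -> 'rV[R]_n -> \bar R).

(** The epigraph of the perturbed value, up to non-attained infima, with every
    term of the criterion bounded by a real number of its own.  The arguments
    [a] and [b] of [phi] and [F] are independent variables and the perturbation
    is deduced from them. *)
Definition value_epi (k : spaceK R T n) (r : R) : Prop :=
  exists (m : 'M[R]_(T.+1, n)) (w : {ffun 'I_T -> 'M[R]_n}) (a : 'rV[R]_T)
    (b : 'M[R]_(T.+1, n)) rl rphi rF,
  [/\ forall t x,
        (perspective (ell t x) (m (tcur t) x) (row x (w t)) <= (rl t x)%:E)%E,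
      forall t, (phi t (a ord0 t) <= (rphi t)%:E)%E,
      forall s, (F s (row s b) <= (rF s)%:E)%E,
      k = residual m0 alpha m w a b
    & r = \sum_t \sum_x rl t x + \sum_t rphi t + \sum_s rF s].

Hypothesis hst : standing_assumption ell phi F.

Let ellNy t x z : ell t x z != -oo%E.
Proof. by case: hst => /(_ t x)[[+ _] _ _] _ _ _; apply. Qed.
Let phiNy t z : phi t z != -oo%E.
Proof. by case: hst => _ _ /(_ t)[[+ _] _ _] _; apply. Qed.
Let FNy s z : F s z != -oo%E.
Proof. by case: hst => _ /(_ s)[[+ _] _ _] _ _; apply. Qed.

Lemma value_epi_convex : convex_epi value_epi.
Proof.
case: hst => hl hF hphi _ k k' r r' c c01.
move=> [m [w [a [b [rl [rphi [rF [h1 h2 h3 -> ->]]]]]]]].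
move=> [m' [w' [a' [b' [rl' [rphi' [rF' [h1' h2' h3' -> ->]]]]]]]].
exists (c *: m + (1 - c) *: m'), (c *: w + (1 - c) *: w').
exists (c *: a + (1 - c) *: a'), (c *: b + (1 - c) *: b').
exists (fun t x => c * rl t x + (1 - c) * rl' t x).
exists (fun t => c * rphi t + (1 - c) * rphi' t).
exists (fun s => c * rF s + (1 - c) * rF' s).
split.
- move=> t x; have [_ cl _] := hl t x.
  have := perspective_epi cl c01 (h1 t x) (h1' t x).
  by rewrite !mxE !ffunE !linearD !linearZ.
- move=> t; have [_ cphi _] := hphi t.
  by have := econvex_epi cphi c01 (h2 t) (h2' t); rewrite !mxE.
- move=> s; have [_ cF _] := hF s.
  by have := econvex_epi cF c01 (h3 s) (h3' s); rewrite !linearD !linearZ.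
- exact: residual_comb.
- under [in RHS]eq_bigr do rewrite big_split/= -!mulr_sumr.
  rewrite !big_split/= -!mulr_sumr.
  by ring.
Qed.

(** For [k = 0], [a] and [b] are forced to be [A w] and [m]: the
    points of [value_epi] over 0 are those of the primal problem itself. *)
Lemma primal_value_epi mw :
  primal_feasible m0 mw -> (primal_criterion alpha ell phi F mw < +oo)%E ->
  exists2 r, primal_criterion alpha ell phi F mw = r%:E & value_epi 0 r.
Proof.
case: mw => m w /= feas fin.
have pNy t x := perspective_gtNy (m (tcur t) x) (row x (w t)) (ellNy t x).
have sNy t := sum_gtNy (pNy t).
have [fin1 finF] := adde_finite (adde_gtNy (sum_gtNy sNy)
  (sum_gtNy (fun t => phiNy t (opA alpha w t)))) (sum_gtNy (fun s => FNy s _)) fin.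
have [finl finphi] := adde_finite (sum_gtNy sNy) (sum_gtNy (fun t => phiNy t _)) fin1.
have [rl1 rl1E lE] := sum_finite sNy finl.
have rowfin t : exists g : 'I_n -> R,
    (forall x, perspective (ell t x) (m (tcur t) x) (row x (w t)) = (g x)%:E)
    /\ rl1 t = \sum_x g x.
  have [|g gE gs] := @sum_finite _ _ _ (pNy t); first by rewrite rl1E ltry.
  by exists g; split=> //; move: (rl1E t); rewrite gs => -[].
have [rl rlE] := choice rowfin.
have [rphi rphiE pE] := sum_finite (fun t => phiNy t _) finphi.
have [rF rFE FE] := sum_finite (fun s => FNy s _) finF.
exists (\sum_t \sum_x rl t x + \sum_t rphi t + \sum_s rF s).
  rewrite lE pE FE -!EFinD; congr ((_ + _ + _)%:E).
  by apply: eq_bigr => t _; case: (rlE t).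
exists m, w, (\row_t opA alpha w t), m, rl, rphi, rF; split=> //.
- by move=> t x; rewrite (rlE t).1.
- by move=> t; rewrite mxE rphiE.
- by move=> s; rewrite rFE.
- rewrite /residual !subrr.
  have -> : m - opS w - m0bar m0 = - (opS w - m + m0bar m0).
    by rewrite opprD opprB.
  by rewrite feas oppr0.
Qed.

Lemma value_epi_primal r : value_epi 0 r ->
  exists2 mw, primal_feasible m0 mw &
    (primal_criterion alpha ell phi F mw <= r%:E)%E.
Proof.
move=> [m [w [a [b [rl [rphi [rF [h1 h2 h3 [] e1 e2 e3 ->]]]]]]]].
exists (m, w) => /=.
  have -> : opS w - m + m0bar m0 = - (m - opS w - m0bar m0).
    by rewrite [RHS]opprD opprK opprB.
  by rewrite -e1 oppr0.
move/esym/subr0_eq: e2 h3 => -> h3.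
have aE t : a 0 t = opA alpha w t.
  by move/esym/subr0_eq/rowP: e3 => ->; rewrite mxE.
rewrite !EFinD -!sumEFin !leeD//.
- by apply: lee_sum => t _; rewrite -sumEFin; apply: lee_sum => x _.
- by apply: lee_sum => t _; rewrite -aE.
- by apply: lee_sum => s _.
Qed.

(** The qualification assumption perturbs the initial law by [+ eps1] but the
    later ones by [- eps1], whereas the residual has the sign [+] at all times;
    [flip] exchanges the two conventions and preserves the norm. *)
Lemma value_epi_absorbing : qualification m0 alpha ell phi F ->
  absorbing_epi value_epi.
Proof.
case: hst => _ _ _ hdom [a0 a0_gt0 hq] d.
pose flip (k : spaceK R T n) : spaceK R T n :=
  (\matrix_(s, x) (if s == ord0 then k.1.1 s x else - k.1.1 s x), k.1.2, k.2).
have flip_norm k : normK (flip k) = normK k.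
  rewrite !normKE /dotK /=; congr (Num.sqrt (_ + _ + _)).
  apply: eq_bigr => s _; apply: eq_bigr => x _; rewrite mxE.
  by case: ifP => // _; rewrite mulrNN.
(* The [+ 1] gives a positive denominator also for [d = 0]. *)
pose t := a0 / (normK d + 1).
have nd : 0 <= normK d by rewrite normKE sqrtr_ge0.
have t0 : 0 < t by rewrite divr_gt0// ltr_wpDl.
exists t; pose k := t *: d.
have : normK (flip k) <= a0.
  rewrite flip_norm normKE dotKZr dotKC dotKZr mulrA -expr2 sqrtrM ?sqr_ge0//.
  rewrite sqrtr_sqr gtr0_norm// -normKE /t mulrAC ler_pdivrMr ?ltr_wpDl//.
  by rewrite ler_pM2l// lerDl.
move=> /hq[pi [hpi [m1 [hm1 m1ge0 hF hphi]]]].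
pose w := [ffun t => \matrix_(x, y) (m1 (tcur t) x * pi t x y)].
pose b := m1 + k.1.2; pose a := \row_t (opA alpha w t + k.2 0 t).
have kE : k = residual m0 alpha m1 w a b.
  rewrite /residual /b /a.
  have -> : m1 - opS w - m0bar m0 = k.1.1.
    case: hm1 => h0 hS; apply/matrixP => s x; rewrite !mxE.
    case: unliftP => [s'|] ->.
      rewrite /= subr0; move: (hS s' x); rewrite !mxE /= => ->.
      under [X in _ - X]eq_bigr do rewrite ffunE mxE.
      ring.
    by rewrite eqxx; move: (h0 x); rewrite !mxE /= => <-; ring.
  have -> : m1 + k.1.2 - m1 = k.1.2 by rewrite addrC addKr.
  rewrite (_ : _ - _ = k.2); last first.
    by apply/rowP => s; rewrite !mxE addrC addKr.
  by case: (k) => -[].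
have aE s : a 0 s = perturbed_D alpha (flip k) pi m1 s.
  rewrite mxE /perturbed_D /=; congr (_ + _); rewrite /opA.
  by apply: eq_bigr => x _; apply: eq_bigr => y _; rewrite ffunE mxE.
exists (\sum_t \sum_x (m1 (tcur t) x * fine (ell t x (row x (pi t))))
   + \sum_t fine (phi t (a 0 t)) + \sum_s fine (F s (row s b))) => //.
exists m1, w, a, b, (fun t x => m1 (tcur t) x * fine (ell t x (row x (pi t)))),
 (fun t => fine (phi t (a 0 t))), (fun s => fine (F s (row s b))); split=> //.
- move=> s x; apply/perspective_leP.
  have wE : row x (w s) = m1 (tcur s) x *: row x (pi s).
    by apply/rowP => y; rewrite ffunE !mxE.
  have := m1ge0 (tcur s) x; rewrite le_eqVlt => /predU1P[m10|m10]; [right|left].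
    by rewrite wE -m10 scale0r mul0r.
  split=> //; rewrite wE scalerA mulVf ?gt_eqF// scale1r mulKf ?gt_eqF//.
  by rewrite -finite_epi//; exact: hpi.
- by move=> s; rewrite -finite_epi// aE; exact: hphi.
- by move=> s; rewrite -finite_epi//; exact: hF.
Qed.

(** A finite criterion at [k = 0] makes [w t] a transport plan of mass 1, from
    [m t] to [m (t + 1)].  All the arguments of [ell], [F] and [phi] are thus in
    fixed compact sets. *)
Lemma value_epi_bounded_below : simplex m0 ->
  exists C, forall r, value_epi 0 r -> C <= r.
Proof.
move=> hm0; case: hst => hl hF hphi hdom.
pose box := [set v : 'rV[R]_n | forall i, `[(0 : R), 1]%classic (v ord0 i)].
have cbox : compact box.
  by apply: (@rV_compact R n (fun=> `[0, 1]%classic)) => i; exact: segment_compact.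
have boxP (v : 'rV[R]_n) : (forall i, 0 <= v 0 i <= 1) -> box v.
  by move=> h i; rewrite /= in_itv /=.
have [Cl hCl] : exists Cl : 'I_T * 'I_n -> R, forall tx, 0 <= Cl tx /\
    forall z, box z -> ((- Cl tx)%:E <= ell tx.1 tx.2 z)%E.
  suff h tx : exists C, 0 <= C /\
      forall z, box z -> ((- C)%:E <= ell tx.1 tx.2 z)%E by have [f] := choice h; exists f.
  have [_ _ ll] := hl tx.1 tx.2.
  by have [C C0 hC] := lsc_bounded_below cbox ll (@ellNy _ _); exists C.
have [CF hCF] : exists CF : 'I_T.+1 -> R, forall s,
    forall z, box z -> ((- CF s)%:E <= F s z)%E.
  suff h s : exists C, forall z, box z -> ((- C)%:E <= F s z)%E.
    by have [f] := choice h; exists f.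
  have [_ _ ll] := hF s.
  by have [C C0 hC] := lsc_bounded_below cbox ll (@FNy _); exists C.
pose B t := \sum_x \sum_y `|alpha t x y|.
have [Cp hCp] : exists Cp : 'I_T -> R, forall t,
    forall z, `|z| <= B t -> ((- Cp t)%:E <= phi t z)%E.
  suff h t : exists C, forall z, `|z| <= B t -> ((- C)%:E <= phi t z)%E.
    by have [f] := choice h; exists f.
  have [_ _ ll] := hphi t.
  have [C C0 hC] := lsc_bounded_below (@segment_compact R (- B t) (B t)) ll (@phiNy _).
  by exists C => z zB; apply: hC; rewrite /= in_itv /= -ler_norml.
exists (\sum_t \sum_x (- Cl (t, x)) + \sum_t (- Cp t) + \sum_s (- CF s)) => r.
move=> [m [w [a [b [rl [rphi [rF [h1 h2 h3 [] e1 e2 e3 ->]]]]]]]].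
move/esym/subr0_eq: e2 h3 => -> h3.
have aE t : a 0 t = opA alpha w t.
  by move/esym/subr0_eq/rowP: e3 => ->; rewrite mxE.
have hw t x := perspective_bounds (hdom t x)
  (fun z hz => (hCl (t, x)).2 z (boxP z hz)) (h1 t x).
have mE s x : m s x = opS w s x + m0bar m0 s x.
  move/matrixP: e1 => /(_ s x); rewrite !mxE; lra.
have m0E x : m ord0 x = m0 0 x.
  by rewrite mE !mxE unlift_none eqxx add0r.
have mSE t x : m (tsucc t) x = \sum_y w t y x.
  by rewrite mE !mxE liftK addr0.
have w0 t x y : 0 <= w t x y by have [/(_ y) + _ _] := hw t x; rewrite mxE.
have wsum t x : \sum_y w t x y = m (tcur t) x.
  by have [_ <- _] := hw t x; apply: eq_bigr => y _; rewrite mxE.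
have m_ge0 s x : 0 <= m s x.
  rewrite mE !mxE; case: unliftP => [t|] ->.
    by rewrite /= addr0 sumr_ge0.
  by rewrite eqxx add0r; have [/(_ x)/andP[]] := hm0.
have msum s : \sum_x m s x = 1.
  case: s => s; elim: s => [|s IH] hs.
    rewrite (_ : Ordinal hs = ord0); last exact/val_inj.
    by under eq_bigr do rewrite m0E; case: hm0.
  have hs' : (s < T)%N by [].
  rewrite (_ : Ordinal hs = tsucc (Ordinal hs')); last exact/val_inj.
  under eq_bigr do rewrite mSE.
  rewrite exchange_big /=; under eq_bigr do rewrite wsum.
  rewrite -(IH (ltnW hs)); apply: eq_bigr => x _; congr (m _ x).
  exact/val_inj.
have m_le1 s x : m s x <= 1.
  by rewrite -(msum s) (bigD1 x)//= lerDl sumr_ge0.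
have w_le1 t x y : w t x y <= 1.
  apply: le_trans (m_le1 (tcur t) x).
  by rewrite -(wsum t x) (bigD1 y)//= lerDl sumr_ge0.
rewrite !lerD//; apply: ler_sum => t _.
- apply: ler_sum => x _; have [_ _] := hw t x; apply: le_trans.
  by rewrite lerN2 ler_piMl//; case: (hCl (t, x)).
- rewrite -lee_fin; apply: (le_trans _ (h2 t)); apply: hCp; rewrite aE /opA.
  apply: le_trans (ler_norm_sum _ _ _) _; apply: ler_sum => x _.
  apply: le_trans (ler_norm_sum _ _ _) _; apply: ler_sum => y _.
  by rewrite normrM ger0_norm// ler_piMl.
- rewrite -lee_fin; apply: (le_trans _ (h3 t)); apply: hCF; apply: boxP => x.
  by rewrite mxE m_ge0 m_le1.
Qed.

(** * Duality *)

(** The Fenchel-Young inequalities of all the terms of the criterion, added up.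
    For [k = 0] this is weak duality; at a solution of (D) it says that the
    solution is a subgradient of the value at 0. *)
Lemma weak_duality (y k : spaceK R T n) (r : R) :
  dual_feasible alpha ell y -> value_epi k r ->
  (dual_criterion m0 phi F y <= (r - dotK y k)%:E)%E.
Proof.
case: y => -[u g] P [hfeas hT].
move=> [m [w [a [b [rl [rphi [rF [h1 h2 h3 -> ->]]]]]]]].
rewrite dotK_residual.
have hpersp t x : (u (tcur t) x - g (tcur t) x) * m (tcur t) x
    + dotv (conj_point alpha u P t x) (row x (w t)) <= rl t x.
  by apply: perspective_young (h1 t x); rewrite -shift_le0; exact: hfeas.
have hsum : \sum_t \sum_x ((u (tcur t) x - g (tcur t) x) * m (tcur t) x
    + dotv (conj_point alpha u P t x) (row x (w t))) <= \sum_t \sum_x rl t x.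
  by apply: ler_sum => t _; apply: ler_sum => x _.
rewrite [X in _ - (_ + X)]big1 ?addr0 => [|x _]; last by rewrite hT subrr mul0r.
have hp : ((\sum_t (P 0 t * a 0 t - rphi t))%:E <= \sum_t conjr (phi t) (P ord0 t))%E.
  by rewrite -sumEFin; apply: lee_sum => t _; apply: fenchel_young.
have hF : ((\sum_s (dotv (row s g) (row s b) - rF s))%:E
    <= \sum_s conjv (F s) (row s g))%E.
  by rewrite -sumEFin; apply: lee_sum => s _; apply: fenchel_young.
apply: (le_trans (leeB (leeB (lexx _) hp) hF)).
rewrite -!EFinB lee_fin !sumrB; lra.
Qed.

Section SupportingDualVariable.
Variables (u g : 'M[R]_(T.+1, n)) (P : 'rV[R]_T) (v : R).
Hypothesis supp : forall k r, value_epi k r -> v + dotK (u, g, P) k <= r.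
Hypothesis nonempty : exists k r, value_epi k r.

Lemma supporting_lagrangian (m : 'M[R]_(T.+1, n)) (w : {ffun 'I_T -> 'M[R]_n})
    (a : 'rV[R]_T) (b : 'M[R]_(T.+1, n)) rl rphi rF :
  (forall t x, (perspective (ell t x) (m (tcur t) x) (row x (w t)) <= (rl t x)%:E)%E) ->
    (forall t, (phi t (a ord0 t) <= (rphi t)%:E)%E) ->
    (forall s, (F s (row s b) <= (rF s)%:E)%E) ->
  v + dotK (u, g, P) (residual m0 alpha m w a b)
    <= \sum_t \sum_x rl t x + \sum_t rphi t + \sum_s rF s.
Proof.
by move=> h1 h2 h3; apply: supp; exists m, w, a, b, rl, rphi, rF.
Qed.

(** Fix a point at which [phi] and [F] are finite, and let [(m, w)] vary.  The
    constraint at [(t, x)] comes from the ray [th (1, z)] of arguments of the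
    perspective at [(t, x)], letting [th] go to infinity for each [z] in the
    domain of [ell t x]; the equality at the final time comes from giving to [m]
    both large positive and large negative masses at [(T, x)]. *)
Lemma supporting_feasible : dual_feasible alpha ell (u, g, P).
Proof.
have [k1 [r1 [_ [_ [a1 [b1 [_ [rphi1 [rF1 [_ hphi1 hF1 _ _]]]]]]]]]] := nonempty.
pose c1 := \sum_t rphi1 t + \sum_s rF1 s + \sum_x m0 0 x * u ord0 x
  - \sum_t P 0 t * a1 0 t - \sum_s dotv (row s g) (row s b1).
have hLag (m : 'M[R]_(T.+1, n)) (w : {ffun 'I_T -> 'M[R]_n}) rl :
    (forall t x, (perspective (ell t x) (m (tcur t) x) (row x (w t)) <= (rl t x)%:E)%E) ->
    v + \sum_t \sum_x ((u (tcur t) x - g (tcur t) x) * m (tcur t) x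
                   + dotv (conj_point alpha u P t x) (row x (w t)))
    + \sum_x (u ord_max x - g ord_max x) * m ord_max x
    <= \sum_t \sum_x rl t x + c1.
  move=> h1; have := supporting_lagrangian h1 hphi1 hF1.
  rewrite dotK_residual /c1; lra.
have tcur_max (t : 'I_T) : (tcur t == ord_max) = false.
  by rewrite -val_eqE /= ltn_eqF.
split=> [t x|x].
  rewrite shift_le0; apply: (@le_trans _ _ ((u (tcur t) x - g (tcur t) x)%:E
     + (g (tcur t) x - u (tcur t) x)%:E)%E); last first.
    by rewrite -EFinD lee_fin; lra.
  apply: leeD2l; apply: fenchel_le => // z r hz.
  suff : (u (tcur t) x - g (tcur t) x) + dotv (conj_point alpha u P t x) z - r <= 0.
    by rewrite /conj_point; lra.
  apply: (@ray_le0 _ (v - c1)) => th th0.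
  (* The mass [th] sits at [(t, x)] and moves along [z]; nothing else moves. *)
  pose m : 'M[R]_(T.+1, n) := th *: delta_mx (tcur t) x.
  pose w := [ffun t' : 'I_T => if t' == t then th *: (delta_mx x 0 *m z) else 0].
  have wE t' x' : row x' (w t') = if (t' == t) && (x' == x) then th *: z else 0.
    rewrite ffunE; case: eqP => _ /=; last by rewrite linear0.
    rewrite linearZ /= row_mul; case: eqP => [->|/eqP ne].
      rewrite (_ : row x (delta_mx x 0) = 1%:M) ?mul1mx//.
      by apply/matrixP => i j; rewrite !mxE !ord1 !eqxx.
    rewrite (_ : row x' (delta_mx x 0) = 0) ?mul0mx ?scaler0//.
    by apply/matrixP => i j; rewrite !mxE (negbTE ne).
  have mE t' x' : m (tcur t') x' = if (t' == t) && (x' == x) then th else 0.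
    rewrite !mxE -val_eqE /= val_eqE.
    by case: ifP => _; rewrite ?mulr1 ?mulr0.
  have := hLag m w (fun t' x' => if (t' == t) && (x' == x) then th * r else 0).
  rewrite [X in _ + X <= _]big1 ?addr0; last first.
    by move=> x' _; rewrite !mxE eq_sym tcur_max mulr0 mulr0.
  have big2 (f : 'I_T -> 'I_n -> R) :
      (forall t' x', (t' == t) && (x' == x) = false -> f t' x' = 0) ->
      \sum_t' \sum_x' f t' x' = f t x.
    move=> f0; rewrite (bigD1 t)//= [X in _ + X]big1 ?addr0 => [|t' ne].
      by rewrite (bigD1 x)//= big1 ?addr0// => x' ne; rewrite f0// (negbTE ne) andbF.
    by rewrite big1// => x' _; rewrite f0// (negbTE ne).
  rewrite big2 => [|t' x' ne]; last by rewrite mE wE ne mulr0 dotv0 addr0.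
  rewrite big2 => [|t' x' ->//].
  rewrite mE wE !eqxx /=.
  rewrite dotvZr.
  move=> h; suff : v + ((u (tcur t) x - g (tcur t) x) * th
     + th * dotv (conj_point alpha u P t x) z) <= th * r + c1 by lra.
  apply: h => t' x'; rewrite mE wE.
  case: ifP => [/andP[/eqP-> /eqP->]|_]; last exact: perspective00_le.
  by apply/perspective_leP; left; rewrite scalerA !mulKf ?mulVf ?gt_eqF// scale1r.
have hx s : s * (u ord_max x - g ord_max x) <= c1 - v.
  pose m : 'M[R]_(T.+1, n) := s *: delta_mx ord_max x.
  have mE t' x' : m (tcur t') x' = 0 by rewrite !mxE tcur_max mulr0.
  have := hLag m 0 (fun _ _ => 0).
  rewrite [X in _ + X + _]big1 ?addr0 => [|t' _]; last first.
    by rewrite big1// => x' _; rewrite mE mulr0 ffunE linear0 dotv0 addr0.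
  rewrite (bigD1 x)//= [X in _ + (_ + X)]big1 ?addr0 => [|x' ne]; last first.
    by rewrite !mxE (negbTE ne) andbF !mulr0.
  rewrite [X in _ <= X + _]big1 ?add0r => [|t' _]; last by rewrite big1.
  rewrite !mxE !eqxx mulr1 => h.
  suff : v + (u ord_max x - g ord_max x) * s <= c1 by lra.
  by apply: h => t' x'; rewrite mE ffunE linear0; exact: perspective00_le.
apply/eqP; rewrite -subr_eq0 eq_le; apply/andP; split.
  by apply: (@ray_le0 _ (v - c1)) => th _; have := hx th; lra.
rewrite -oppr_le0; apply: (@ray_le0 _ (v - c1)) => th _.
by have := hx (- th); lra.
Qed.

(** With [m = 0] and [w = 0] only the terms in [a] and [b] are left, and these
    vary independently. *)
Lemma supporting_dual_criterion :
  (v%:E <= dual_criterion m0 phi F (u, g, P))%E.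
Proof.
have [k1 [r1 [_ [_ [a1 [b1 [_ [rphi1 [rF1 [_ hphi1 hF1 _ _]]]]]]]]]] := nonempty.
have hconj (a : 'rV[R]_T) (b : 'M[R]_(T.+1, n)) rphi rF :
    (forall t, (phi t (a ord0 t) <= (rphi t)%:E)%E) ->
    (forall s, (F s (row s b) <= (rF s)%:E)%E) ->
    \sum_t (P 0 t * a 0 t - rphi t) + \sum_s (dotv (row s g) (row s b) - rF s)
      <= \sum_x m0 0 x * u ord0 x - v.
  move=> h2 h3; have := @supporting_lagrangian 0 0 a b (fun _ _ => 0) rphi rF _ h2 h3.
  rewrite dotK_residual !sumrB.
  rewrite [X in _ + (_ + X + _) <= _]big1 => [|t _]; last first.
    by rewrite big1// => x _; rewrite mxE ffunE linear0 dotv0 mulr0 addr0.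
  rewrite [X in _ + (_ + X) <= _]big1 => [|x _]; last by rewrite mxE mulr0.
  rewrite [X in _ <= X + _ + _]big1 => [|t _]; last by rewrite big1.
  move=> h; suff h0 : forall t x, (perspective (ell t x) ((0 : 'M[R]_(T.+1, n)) (tcur t) x)
      (row x ((0 : {ffun 'I_T -> 'M[R]_n}) t)) <= 0%:E)%E by have := h h0; lra.
  by move=> t x; rewrite mxE ffunE linear0; exact: perspective00_le.
pose Bphi t := [set q | exists z r, (phi t z <= r%:E)%E /\ q = P 0 t * z - r].
pose BF s := [set q | exists z r, (F s z <= r%:E)%E /\ q = dotv (row s g) z - r].
have hB bphi bF : (forall t, Bphi t (bphi t)) -> (forall s, BF s (bF s)) ->
    \sum_t bphi t + \sum_s bF s <= \sum_x m0 0 x * u ord0 x - v.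
  move=> /choice[a /choice[rphi h2]] /choice[b /choice[rF h3]].
  have := hconj (\row_t a t) (\matrix_s b s) rphi rF.
  under eq_bigr do rewrite mxE -(h2 _).2.
  under [X in _ + X]eq_bigr do rewrite rowK -(h3 _).2.
  apply=> [t|s]; first by rewrite mxE; case: (h2 t).
  by rewrite rowK; case: (h3 s).
have BF0 s : BF s !=set0 by exists (dotv (row s g) (row s b1) - rF1 s), (row s b1), (rF1 s).
have Bphi0 t : Bphi t !=set0 by exists (P 0 t * a1 0 t - rphi1 t), (a1 0 t), (rphi1 t).
(* The suprema defining all the conjugates are taken together, whence a single
   family indexed by a disjoint union. *)
pose B (i : 'I_T + 'I_T.+1) := match i with inl t => Bphi t | inr s => BF s end.
have [|b hb|sB [sBub sBle]] := @separable_sup _ _ B (\sum_x m0 0 x * u ord0 x - v).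
- by case=> [t|s]; [exact: Bphi0 | exact: BF0].
- rewrite big_sumType /=; apply: hB => [t|s]; first exact: (hb (inl t)).
  exact: (hb (inr s)).
rewrite big_sumType /= in sBle.
have hp : (\sum_t conjr (phi t) (P ord0 t) <= (\sum_t sB (inl t))%:E)%E.
  rewrite -sumEFin; apply: lee_sum => t _; apply: fenchel_le => // z r hz.
  by apply: (sBub (inl t)); exists z, r.
have hF : (\sum_s conjv (F s) (row s g) <= (\sum_s sB (inr s))%:E)%E.
  rewrite -sumEFin; apply: lee_sum => s _; apply: fenchel_le => // z r hz.
  by apply: (sBub (inr s)); exists z, r.
apply: (le_trans _ (leeB (leeB (lexx _) hp) hF)).
by rewrite -!EFinB lee_fin; lra.
Qed.

End SupportingDualVariable.

End PerturbedProblem.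

Theorem theorem4p4 (R : realType) (T n : nat) (hT : (1 <= T)%N) (hn : (1 <= n)%N)
    (m0 : 'rV[R]_n) (alpha : 'I_T -> 'M[R]_n)
    (ell : 'I_T -> 'I_n -> 'rV[R]_n -> \bar R)
    (phi : 'I_T -> R -> \bar R)
    (F : 'I_T.+1 -> 'rV[R]_n -> \bar R)
    (hm0 : simplex m0)
    (hstanding : standing_assumption ell phi F)
    (hqualif : qualification m0 alpha ell phi F) :
  [/\ dual_solutions m0 alpha ell phi F !=set0,
      exists M : R, forall k, dual_solutions m0 alpha ell phi F k -> normK k <= M
    & dual_value m0 alpha ell phi F = primal_value m0 alpha ell phi F].
Proof.
have abs := value_epi_absorbing hstanding hqualif.
have [s0 [r0 _]] := abs 0; rewrite scaler0 => hr0.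
have [C hC] := value_epi_bounded_below alpha hstanding hm0.
set pv := primal_value m0 alpha ell phi F.
have pv_le r : value_epi m0 alpha ell phi F 0 r -> (pv <= r%:E)%E.
  move=> /value_epi_primal[mw feas]; apply: le_trans.
  by apply: ereal_inf_lbound; exists mw.
have le_pv (c : \bar R) :
    (forall r, value_epi m0 alpha ell phi F 0 r -> (c <= r%:E)%E) -> (c <= pv)%E.
  move=> hc; apply: le_ereal_inf_tmp => _ [mw feas <-].
  have [fin|] := ltP (primal_criterion alpha ell phi F mw) +oo%E; last first.
    by rewrite leye_eq => /eqP ->; rewrite leey.
  by have [r -> /hc] := primal_value_epi hstanding feas fin.
have Cpv : (C%:E <= pv)%E by apply: le_pv => r /hC; rewrite lee_fin.
have [v pvE] : exists v, pv = v%:E.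
  by case: (pv) Cpv (pv_le _ hr0) => [v| |] // _ _; exists v.
have v_le r : value_epi m0 alpha ell phi F 0 r -> v <= r.
  by move/pv_le; rewrite pvE lee_fin.
have [c hc] := subgradient_seq (@unitK R T n) (index_enum_uniq _)
  (value_epi_convex hstanding) abs v_le.
(* A subgradient at 0 is a solution of the dual problem. *)
have [feas D_ge] : dual_feasible alpha ell (vecK c) /\
    (v%:E <= dual_criterion m0 phi F (vecK c))%E.
  have supp k r : value_epi m0 alpha ell phi F k r -> v + dotK (vecK c) k <= r.
    have [d ->] := vecK_onto k.
    by rewrite {1}vecK_sum dotKC dotK_vecK => /hc.
  have nonempty : exists k r, value_epi m0 alpha ell phi F k r by exists 0, r0.
  split; first exact: supporting_feasible supp nonempty.
  exact: supporting_dual_criterion supp nonempty.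
have weak y : dual_feasible alpha ell y -> (dual_criterion m0 phi F y <= pv)%E.
  move=> fy; apply: le_pv => r hr; have := weak_duality fy hr.
  by rewrite -[X in dotK y X](scale0r 0) dotKZr mul0r subr0.
have dvE : dual_value m0 alpha ell phi F = pv.
  apply/eqP; rewrite eq_le; apply/andP; split.
    by apply: ge_ereal_sup => _ [y fy <-]; exact: weak.
  by rewrite pvE; apply: (le_trans D_ge); apply: ereal_sup_ubound; exists (vecK c).
split=> //.
- exists (vecK c); split=> //; rewrite dvE; apply/eqP.
  by rewrite eq_le weak//= pvE.
- apply: bounded_of_directions => d; have [t [r t0 hr]] := abs d.
  exists ((r - v) / t) => y [fy yE].
  have := weak_duality fy hr.
  rewrite yE dvE pvE lee_fin dotKZr ler_pdivlMr//; lra.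
Qed.
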